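(* Let $G$ be a finite, simple, connected graph. Then $\overrightarrow{\beta}(G,1)\le 1$ (equivalently, $\overrightarrow{\beta}(G,1)=1$) if and only if $G$ contains at most one cycle.
   Context: Firefighting on oriented graphs: an orientation $\overrightarrow{G}$ of a finite simple graph $G$ replaces each edge $uv$ by exactly one of the arcs $\overrightarrow{uv}$, $\overrightarrow{vu}$. Let $f\ge 1$ be an integer. A fire breaks out at a vertex $v$ at time $1$ ($v$ burns). At the end of each time unit, the firefighters permanently protect up to $f$ vertices that are neither burning nor already protected. At the next time unit, every vertex that is neither burning nor protected and is an out-neighbour of a burning vertex starts to burn. The process ends when no new vertex can burn. $\beta(\overrightarrow{G},f)$ is the maximum, over all starting vertices $v$, of the minimum, over all protection strategies, of the number of vertices that burn. $\overrightarrow{\beta}(G,f)$ is the minimum of $\beta(\overrightarrow{G},f)$ over all orientations $\overrightarrow{G}$ of $G$. (Always $\overrightarrow{\beta}(G,f)\ge 1$.) *)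

(* Defs.v *)
From mathcomp Require Import all_boot.

Set Implicit Arguments.
Unset Strict Implicit.
Unset Printing Implicit Defensive.

(* A finite simple graph is a symmetric irreflexive [e : rel T]; an orientation
   of it is given by its set of arcs. *)
Definition orientation (T : finType) (e : rel T) (A : {set T * T}) : bool :=
  [forall u, forall v,
     if e u v then ((u, v) \in A) (+) ((v, u) \in A) else (u, v) \notin A].

Definition connected_graph (T : finType) (e : rel T) : Prop :=
  0 < #|T| /\ forall x y, connect e x y.

(* Indices start at 0: index [t] stands for time unit [t + 1], and [P t] is the
   set of vertices that become protected at the end of that time unit.
   [protected P t] is what is protected just before [P t] is added. *)
Definition protected (T : finType) (P : nat -> {set T}) (t : nat) : {set T} :=
  \bigcup_(i < t) P i.

Fixpoint burning (T : finType) (A : {set T * T}) (P : nat -> {set T}) (v : T)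
    (t : nat) : {set T} :=
  if t is t'.+1 then
    let B := burning A P v t' in
    B :|: [set w | (w \notin protected P t'.+1) && [exists u in B, (u, w) \in A]]
  else [set v].

Definition legal_move (T : finType) (A : {set T * T}) (f : nat)
    (P : nat -> {set T}) (v : T) (t : nat) : bool :=
  (#|P t| <= f) && [disjoint P t & burning A P v t :|: protected P t].

(* The fire no longer spreads from index [#|T|] on, whatever the protections
   are, so a strategy only matters up to there. *)
Lemma burning_stationary (T : finType) (A : {set T * T}) (P : nat -> {set T})
    (v : T) (t : nat) :
  #|T| <= t -> burning A P v t = burning A P v #|T|.
Proof.
have stepS n : burning A P v n \subset burning A P v n.+1 by exact: subsetUl.
have stop n : burning A P v n.+1 = burning A P v n ->
    burning A P v n.+2 = burning A P v n.+1.
  move=> eqn; apply/eqP; rewrite eqEsubset stepS andbT.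
  apply/subsetP=> w; rewrite [burning A P v n.+2]/= -/(burning A P v n.+1).
  case/setUP=> //; rewrite inE => /andP[wP /exists_inP[u uB uw]].
  rewrite [burning A P v n.+1]/=; apply/setUP; right; rewrite inE.
  apply/andP; split; last first.
    by apply/exists_inP; exists u; rewrite -?eqn.
  apply: contra wP; rewrite /protected (big_ord_recr n.+1) /= => wP.
  by apply/setUP; left.
have grow n : (burning A P v n.+1 = burning A P v n) \/ n < #|burning A P v n|.
  elim: n => [|n [/stop|IH]]; [by right; rewrite cards1 | by left | ].
  have [/stop|neq] := eqVneq (burning A P v n.+1) (burning A P v n); first by left.
  right; apply: leq_ltn_trans IH _; apply: proper_card.
  by rewrite properEneq eq_sym neq stepS.
have stopT : burning A P v #|T|.+1 = burning A P v #|T|.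
  by case: (grow #|T|) => //; rewrite ltnNge max_card.
move=> /subnK <-; elim: (t - #|T|) => [//|k <-]; rewrite addSn.
by elim: k => [//|k IH]; apply: stop.
Qed.

Definition strategy_fun (T : finType) (s : #|T|.-tuple {set T}) :
  nat -> {set T} := nth set0 s.

Definition legal_strategy (T : finType) (A : {set T * T}) (f : nat) (v : T)
    (s : #|T|.-tuple {set T}) : bool :=
  [forall t : 'I_#|T|, legal_move A f (strategy_fun s) v t].

Definition burnt (T : finType) (A : {set T * T}) (v : T)
    (s : #|T|.-tuple {set T}) : {set T} :=
  burning A (strategy_fun s) v #|T|.

(* In both minima below the default value [#|T|] bounds all the terms from
   above, and the index set is never empty, so it does not affect the result. *)
Definition beta_oriented (T : finType) (A : {set T * T}) (f : nat) : nat :=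
  \max_(v : T)
    \big[minn/#|T|]_(s : #|T|.-tuple {set T} | legal_strategy A f v s)
      #|burnt A v s|.

Definition beta_graph (T : finType) (e : rel T) (f : nat) : nat :=
  \big[minn/#|T|]_(A : {set T * T} | orientation e A) beta_oriented A f.

(* A cycle is a subgraph: cyclic vertex sequences that differ by a rotation or
   a reversal are the same cycle, hence the comparison of edge sets. *)
Definition graph_cycle (T : finType) (e : rel T) (c : seq T) : Prop :=
  2 < size c /\ ucycle e c.

Definition cycle_edges (T : finType) (c : seq T) : {set {set T}} :=
  [set [set x; next c x] | x in c].

Definition at_most_one_cycle (T : finType) (e : rel T) : Prop :=
  forall c1 c2 : seq T, graph_cycle e c1 -> graph_cycle e c2 ->
    cycle_edges c1 = cycle_edges c2.

(* Main.v *)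
Require Import Defs.
From mathcomp Require Import all_boot.

Set Implicit Arguments.
Unset Strict Implicit.
Unset Printing Implicit Defensive.

(** One firefighter confines every fire to its origin exactly when each vertex
    has at most one out-neighbour, so the question is which connected graphs
    have an orientation of out-degree at most one.

    In such an orientation the arcs of a cycle all point the same way around it,
    so a cycle is a periodic orbit of the out-neighbour function [f]; since the
    graph is connected, every vertex flows into the same periodic orbit.

    Conversely, if every edge is a bridge, induction on the number of edges
    orients the graph with out-degree at most one and with prescribed sinks, at
    most one per component: removing [uv] separates [u] from [v], so one of the
    two may be added to the sinks before [uv] is put back as its outgoing arc.
    If some edge [uv] is not a bridge, it lies on the unique cycle, so that
    without [uv] every edge is a bridge; orient the rest with sink [u] and add
    the arc from [u] to [v]. *)

(** * Minima of finite families *)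

Lemma bigminn_leq (I : eqType) (r : seq I) (P : pred I) (F : I -> nat) d i :
  i \in r -> P i -> \big[minn/d]_(j <- r | P j) F j <= F i.
Proof.
elim: r => // a r IH; rewrite inE big_cons => /predU1P[<- ->|ir Pi].
  exact: geq_minl.
by case: ifP => _; rewrite ?geq_min IH ?orbT.
Qed.

(** The minimum may be the default [d] rather than a term, hence the first alternative; with
    [d = #|T|] and [m = 1] it means that there is at most one vertex. *)
Lemma bigminn_witness (I : Type) (r : seq I) (P : pred I) (F : I -> nat) d m :
  \big[minn/d]_(j <- r | P j) F j <= m -> d <= m \/ exists2 i, P i & F i <= m.
Proof.
elim/big_rec: _ => [|i x Pi IH]; first by left.
by rewrite geq_min => /orP[Fi|/IH//]; right; exists i.
Qed.

Definition functional_arcs (T : finType) (A : {set T * T}) : Prop :=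
  forall x y z, (x, y) \in A -> (x, z) \in A -> y = z.

(** * Fires under a fixed set of arcs *)

Section Firefighting.

Variables (T : finType) (A : {set T * T}).

Lemma burning_subset (P : nat -> {set T}) v t t' :
  t <= t' -> burning A P v t \subset burning A P v t'.
Proof.
move=> /subnK <-; elim: (t' - t) => [|k IH]; first by rewrite add0n.
by apply: subset_trans IH _; rewrite addSn /=; exact: subsetUl.
Qed.

Lemma origin_burnt v s : v \in burnt A v s.
Proof. by apply: (subsetP (burning_subset _ _ (leq0n _))); rewrite set11. Qed.

Lemma beta_oriented_gt0 f : 0 < #|T| -> 0 < beta_oriented A f.
Proof.
move=> T0; have /card_gt0P[v _] := T0.
apply: leq_trans (leq_bigmax v); elim/big_ind: _ => //= [m n m0 n0|s _].
  by rewrite leq_min m0.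
by apply/card_gt0P; exists v; exact: origin_burnt.
Qed.

Lemma functional_arcs_confine v :
  (v, v) \notin A -> functional_arcs A ->
  exists2 s, legal_strategy A 1 v s & #|burnt A v s| <= 1.
Proof.
(* Protect the out-neighbour of [v], if any, at index 0 and nothing later. *)
move=> vvA funA; pose P0 := [set w | (v, w) \in A].
have size_s : size (P0 :: nseq #|T|.-1 set0) == #|T|.
  by rewrite /= size_nseq prednK //; apply/card_gt0P; exists v.
pose s := Tuple size_s.
have sE t : strategy_fun s t = if t == 0 then P0 else set0.
  by case: t => [|t] //; rewrite /strategy_fun /= nth_nseq if_same.
have burnE t : burning A (strategy_fun s) v t = [set v].
  elim: t => //= t ->; apply/setP=> w; rewrite !inE orb_idr //.
  case/andP=> wP /exists_inP[u]; rewrite inE => /eqP-> vw.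
  case/negP: wP; rewrite /protected big_ord_recl sE.
  by apply/setUP; left; rewrite inE.
exists s; last by rewrite /burnt burnE cards1.
apply/forallP=> -[t /= _]; rewrite /legal_move sE burnE.
case: eqP => [->|_]; last by rewrite cards0 disjoints_subset sub0set.
apply/andP; split.
  apply/card_le1_eqP=> x y; rewrite !inE => vx vy.
  exact: (funA v).
rewrite /protected big_ord0 setU0 disjoint_sym disjoints1 inE.
exact: vvA.
Qed.

(** A single protected vertex cannot be both [y] and [z], so the other one burns at index 1. *)
Lemma two_out_neighbours_spread v y z s :
  (v, v) \notin A -> (v, y) \in A -> (v, z) \in A -> y != z ->
  legal_strategy A 1 v s -> 1 < #|burnt A v s|.
Proof.
move=> vvA vy vz yz legal_s.
have T0 : 0 < #|T| by apply/card_gt0P; exists v.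
have /andP[P1 _] := forallP legal_s (Ordinal T0).
have [w vw wP] : exists2 w, (v, w) \in A & w \notin strategy_fun s 0.
  have [yP|] := boolP (y \in strategy_fun s 0); last by exists y.
  exists z => //; apply: contra yz => zP; apply/eqP.
  by move/card_le1_eqP: P1; apply.
have wB : w \in burnt A v s.
  (* [T0] also says that index 1 is within the horizon [#|T|]. *)
  apply: (subsetP (burning_subset _ _ T0)); rewrite /= !inE.
  rewrite /protected big_ord1 wP /=; apply/orP; right.
  by apply/exists_inP; exists v; rewrite ?set11.
have v_w : v != w by apply: contraNneq vvA => {2}->.
apply/card_gt1P; exists v, w; split=> //; exact: origin_burnt.
Qed.

Lemma beta_oriented_le1 :
  (forall v, (v, v) \notin A) -> beta_oriented A 1 <= 1 <-> functional_arcs A.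
Proof.
move=> irrA; split=> [/bigmax_leqP le1 v y z vy vz | funA]; last first.
  apply/bigmax_leqP=> v _.
  have [s legal_s] := functional_arcs_confine (irrA v) funA.
  by apply: leq_trans; rewrite bigminn_leq ?mem_index_enum.
apply/eqP; apply/negPn/negP=> yz.
case: (bigminn_witness (le1 v isT)) => [T1|[s legal_s]].
  by move/negP: yz; apply; apply/eqP; move/fintype_le1P: T1 => /(_ y z) ->.
by rewrite leqNgt (two_out_neighbours_spread (irrA v) vy vz yz).
Qed.

End Firefighting.

(** * Cycles as orbits of the out-neighbour function *)

Section Cycles.

Variables (T : finType) (e : rel T).

Lemma next_next_neq (c : seq T) z :
  uniq c -> 2 < size c -> z \in c -> next c (next c z) != z.
Proof.
move=> Uc sc zc; case: (rot_to zc) => i q def_q.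
have: uniq (rot i c) by rewrite rot_uniq.
have: 2 < size (rot i c) by rewrite size_rot.
rewrite -!(next_rot i Uc) def_q.
case: q {def_q} => [|a [|b q]] //= _; rewrite !inE eqxx.
case/and3P=> /norP[za /norP[zb _]] _ _.
by rewrite [a == z]eq_sym (negPf za) eqxx eq_sym.
Qed.

Lemma cycle_edges_rev (c : seq T) :
  uniq c -> cycle_edges (rev c) = cycle_edges c.
Proof.
move=> Uc; apply/eqP; rewrite eqEsubset; apply/andP; split.
  apply/subsetP=> _ /imsetP[x xc ->]; rewrite mem_rev in xc.
  apply/imsetP; exists (prev c x); rewrite ?mem_prev //.
  by rewrite next_rev // next_prev // setUC.
apply/subsetP=> _ /imsetP[x xc ->].
apply/imsetP; exists (next c x); rewrite ?mem_rev ?mem_next //.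
by rewrite next_rev // prev_next // setUC.
Qed.

Lemma orientation_arc (A : {set T * T}) x y :
  orientation e A -> e x y -> (x, y) \in A \/ (y, x) \in A.
Proof.
move=> /forallP/(_ x)/forallP/(_ y) + exy; rewrite exy.
by case: ((x, y) \in A); [left | right].
Qed.

(** Vertices without outgoing arc become fixed points, so that the function is total and has
    orbits. *)
Definition out_neighbour (A : {set T * T}) (x : T) : T :=
  odflt x [pick y | (x, y) \in A].

Lemma out_neighbourE (A : {set T * T}) x y :
  functional_arcs A -> (x, y) \in A -> out_neighbour A x = y.
Proof.
move=> funA xy; rewrite /out_neighbour; case: pickP => [z xz|/(_ y)].
  exact: (funA x).
by rewrite xy.
Qed.

Lemma cycle_is_orbit (A : {set T * T}) c :
  orientation e A -> functional_arcs A -> graph_cycle e c ->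
  exists c', [/\ c' =i c, cycle_edges c' = cycle_edges c
               & fcycle (out_neighbour A) c'].
Proof.
move=> oA funA [sc /andP[cc Uc]].
have back z : z \in c -> (z, next c z) \notin A -> (next c z, z) \in A.
  move=> zc /negP nz; by case: (orientation_arc oA (next_cycle cc zc)).
have [/allP good|/allPn[z zc bad_z]] :=
    boolP (all (fun x => (x, next c x) \in A) c).
  exists c; split=> //; apply: cycle_from_next => // x xc.
  by apply/eqP; apply: out_neighbourE => //; exact: good.
(* One arc against the traversal forces the next one: if [next c y] points back to [y], it cannot
   also point to its successor, which differs from [y] because the cycle has length at least 3. So
   all arcs go backwards and [rev c] is the orbit. *)
have bad x : x \in c -> (x, next c x) \notin A.
  move=> xc; have: fconnect (next c) z x.
    by rewrite (fconnect_cycle (cycle_next Uc)).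
  move/iter_findex <-; elim: (findex _ _ _) => //= n.
  have: iter n (next c) z \in c by elim: n => //= n; rewrite mem_next.
  move: (iter n _ z) => y yc bad_y; apply/negP=> good_y.
  have /eqP := funA _ _ _ good_y (back _ yc bad_y).
  exact/negP/next_next_neq.
exists (rev c); split; [exact: mem_rev | exact: cycle_edges_rev |].
apply: cycle_from_next => [|x]; rewrite ?rev_uniq // mem_rev => xc.
rewrite /= next_rev //; apply/eqP; apply: out_neighbourE => //.
by rewrite -{1}(next_prev Uc x); apply: back; rewrite ?bad ?mem_prev.
Qed.

Lemma fcycle_edges (f : T -> T) (c : seq T) :
  fcycle f c -> cycle_edges c = [set [set x; f x] | x in c].
Proof. by move=> fc; apply: eq_in_imset => x xc; rewrite (nextE fc). Qed.

Lemma functional_orientation_one_cycle (A : {set T * T}) :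
  symmetric e -> (forall x y, connect e x y) ->
  orientation e A -> functional_arcs A -> at_most_one_cycle e.
Proof.
move=> e_sym e_conn oA funA c1 c2 cyc1 cyc2.
have ne c : graph_cycle e c -> exists x, x \in c.
  by case: c => [[]//|x c _]; exists x; exact: mem_head.
have [d1 [m1 <- f1]] := cycle_is_orbit oA funA cyc1.
have [d2 [m2 <- f2]] := cycle_is_orbit oA funA cyc2.
set f := out_neighbour A in f1 f2 *.
have [x1] := ne _ cyc1; rewrite -m1 => x1d.
have [x2] := ne _ cyc2; rewrite -m2 => x2d.
(* [S] is the set of vertices that flow into [d1]. It is closed under adjacency: along an arc out of
   [x], the orbit of [x] either passes through the head or starts on [d1], which [f] preserves. *)
pose S := [set x | [exists y in d1, fconnect f x y]].
have clS : closed e S.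
  apply: intro_closed; first exact: sym_connect_sym.
  move=> x y exy; rewrite !inE => /exists_inP[w wd xw]; apply/exists_inP.
  have [xy|yx] := orientation_arc oA exy.
    move: xw; rewrite fconnect_eqVf /f (out_neighbourE funA xy) -/f.
    case/predU1P=> [xw|yw]; last by exists w.
    exists y => //; rewrite -(out_neighbourE funA xy) -/f.
    by apply: (mem_fcycle f1); rewrite xw.
  exists w => //; apply: connect_trans xw.
  by rewrite -(out_neighbourE funA yx) fconnect1.
have: x2 \in S.
  rewrite -(closed_connect clS (e_conn x1 x2)) inE.
  by apply/exists_inP; exists x1.
(* The orbit of [x2] stays in [d2], so [w] lies on both orbits, and each of them is everything
   reachable from [w]. *)
rewrite inE => /exists_inP[w wd1]; rewrite (fconnect_cycle f2) // => wd2.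
rewrite (fcycle_edges f1) (fcycle_edges f2).
suff d12 : d1 =i d2.
  by apply/setP=> E; apply/imsetP/imsetP=> -[x xd ->]; exists x; rewrite ?d12 // -d12.
by move=> x; rewrite -(fconnect_cycle f1 wd1) -(fconnect_cycle f2 wd2).
Qed.

End Cycles.

(** * Bridges and the construction of an orientation *)

Definition del_edge (T : finType) (e : rel T) (u v : T) : rel T :=
  fun x y => e x y && ([set x; y] != [set u; v]).

(** For symmetric [e] these are the forests. *)
Definition all_bridges (T : finType) (e : rel T) : Prop :=
  forall u v, e u v -> ~~ connect (del_edge e u v) u v.

Section Bridges.

Variables (T : finType).
Implicit Types (e : rel T) (u v : T).

Lemma del_edge_sym e u v : symmetric e -> symmetric (del_edge e u v).
Proof. by move=> e_sym x y; rewrite /del_edge e_sym setUC. Qed.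

Lemma del_edge_sub e u v : subrel (del_edge e u v) e.
Proof. by move=> x y /andP[]. Qed.

Lemma connect_subrel e e' :
  subrel e e' -> subrel (connect e) (connect e').
Proof. by move=> ee'; apply: connect_sub => x y /ee'; exact: connect1. Qed.

Lemma all_bridges_sub e e' : subrel e e' -> all_bridges e' -> all_bridges e.
Proof.
move=> ee' br u v /ee' /br; apply: contra; apply: connect_subrel.
by move=> x y /andP[/ee' exy neq]; rewrite /del_edge exy.
Qed.

Lemma nonbridge_cycle e u v :
  symmetric e -> irreflexive e -> e u v -> connect (del_edge e u v) u v ->
  exists2 c, graph_cycle e c & [set u; v] \in cycle_edges c.
Proof.
move=> e_sym e_irr euv /connectP[p0 pp0 def_v].
case/shortenP: pp0 def_v => p pp Up _ def_v.
exists (u :: p); last first.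
  apply/imsetP; exists v; first by rewrite def_v mem_last.
  suff ->: next (u :: p) v = u by rewrite setUC.
  have <- : prev (u :: p) u = v; last by rewrite next_prev.
  case/andP: Up => up _; rewrite def_v.
  by rewrite prev_nth mem_head memNindex //= (last_nth u).
split; last first.
  rewrite /ucycle Up andbT /= rcons_path -def_v e_sym euv andbT.
  exact: sub_path (@del_edge_sub e _ _) _ _ pp.
(* A shorter path would make [u] equal to [v] or use the deleted edge. *)
case: p pp def_v {Up} => [_ def_v|y [|z p]] //=.
  by rewrite def_v e_irr in euv.
by rewrite /del_edge => /[swap] <-; rewrite eqxx !andbF.
Qed.

(** A non-bridge left after the deletion would lie on a cycle avoiding [uv], whereas the non-bridge
    [uv] lies on a cycle itself; these would be two different cycles of [e]. *)
Lemma del_nonbridge e u v :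
  symmetric e -> irreflexive e -> at_most_one_cycle e ->
  e u v -> connect (del_edge e u v) u v -> all_bridges (del_edge e u v).
Proof.
move=> e_sym e_irr one euv cuv x y xy; apply/negP=> cxy.
have [c1 cyc1 uv1] := nonbridge_cycle e_sym e_irr euv cuv.
have irr' : irreflexive (del_edge e u v) by move=> z; rewrite /del_edge e_irr.
have [c2 [s2 /andP[cc2 Uc2]] _] :=
  nonbridge_cycle (del_edge_sym u v e_sym) irr' xy cxy.
have cyc2 : graph_cycle e c2.
  by split=> //; rewrite /ucycle Uc2 (sub_cycle (@del_edge_sub e u v)).
move: uv1; rewrite (one _ _ cyc1 cyc2) => /imsetP[z zc uvz].
by have := next_cycle cc2 zc; rewrite /del_edge -uvz eqxx andbF.
Qed.

Lemma orientation_add_arc e (A : {set T * T}) u v :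
  symmetric e -> irreflexive e -> e u v ->
  orientation (del_edge e u v) A -> orientation e ((u, v) |: A).
Proof.
move=> e_sym e_irr euv oA; apply/forallP=> x; apply/forallP=> y.
have := forallP (forallP oA x) y; have := forallP (forallP oA y) x.
have uv : u != v by apply: contraTneq euv => ->; rewrite e_irr.
rewrite /del_edge !inE ![_ == (_, _)]xpair_eqE (e_sym y x) [[set y; x]]setUC.
have [exy|nexy] := boolP (e x y) => /=; last first.
  move=> _ xyA; rewrite negb_or xyA andbT.
  by apply: contra nexy => /andP[/eqP-> /eqP->].
have [eqE|neqE] := eqVneq [set x; y] [set u; v] => /=; last first.
  have neqx : (x == u) && (y == v) = false.
    by apply: contraNF neqE => /andP[/eqP-> /eqP->].
  have neqy : (y == u) && (x == v) = false.
    by apply: contraNF neqE => /andP[/eqP-> /eqP->]; rewrite setUC.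
  by rewrite neqx neqy.
(* Here [xy] is the deleted edge, so [A] contains neither of its arcs. *)
move=> /negPf-> /negPf->; rewrite !orbF.
have: u \in [set x; y] by rewrite eqE set21.
have: v \in [set x; y] by rewrite eqE set22.
rewrite !inE => /orP[]/eqP vE /orP[]/eqP uE; move: uv; rewrite vE uE !eqxx //.
  by rewrite eq_sym => /negPf->.
by move=> xy; rewrite (negPf xy) andbF.
Qed.

Definition sinks (A : {set T * T}) (R : {set T}) : Prop :=
  forall x y, x \in R -> (x, y) \notin A.

Lemma functional_add_arc (A : {set T * T}) (R : {set T}) u v :
  functional_arcs A -> sinks A (u |: R) -> functional_arcs ((u, v) |: A).
Proof.
move=> funA sinkA x y z; rewrite !inE !xpair_eqE.
have uA w : ((u, w) \in A) = false by apply: negPf; apply: sinkA; exact: setU11.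
have [->|_] /= := eqVneq x u; last exact: funA.
by rewrite !uA !orbF => /eqP-> /eqP->.
Qed.

(** A tree has one edge fewer than vertices, so out-degree at most one leaves exactly one sink; one
    prescribed sink per component is therefore the most one can ask. *)
Lemma all_bridges_orientation e (R : {set T}) :
  symmetric e -> irreflexive e -> all_bridges e ->
  {in R &, forall x y, connect e x y -> x = y} ->
  exists A, [/\ orientation e A, functional_arcs A & sinks A R].
Proof.
have [n] := ubnP #|[set p | e p.1 p.2]|; elim: n e R => // n IH e R.
rewrite ltnS => le_n e_sym e_irr br indep.
have [[u v] /= euv|no_edge] := pickP (fun p : T * T => e p.1 p.2); last first.
  exists set0; split=> [|x y z|x y _]; rewrite ?inE //.
  apply/forallP=> x; apply/forallP=> y.
  by rewrite (no_edge (x, y)) inE.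
have step a b : e a b ->
    (forall r, r \in R -> ~~ connect (del_edge e a b) a r) ->
    exists A, [/\ orientation e A, functional_arcs A & sinks A R].
  move=> eab nab; set e' := del_edge e a b.
  have sub' : subrel e' e by exact: del_edge_sub.
  have sym' : symmetric e' by exact: del_edge_sym.
  have irr' : irreflexive e' by move=> z; rewrite /e' /del_edge e_irr.
  have [|||||A [oA funA sinkA]] := IH e' (a |: R) => //.
  - apply: leq_trans le_n; apply/proper_card/properP; split.
      by apply/subsetP=> p; rewrite !inE => /andP[].
    by exists (a, b); rewrite inE //= /e' /del_edge eqxx andbF.
  - exact: all_bridges_sub br.
  - move=> x y; rewrite !inE => /predU1P[->|xR] /predU1P[->|yR] //.
    + by rewrite (negPf (nab _ yR)).
    + by rewrite (sym_connect_sym sym') (negPf (nab _ xR)).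
    + by move/(connect_subrel sub'); exact: indep.
  exists ((a, b) |: A); split.
  - exact: orientation_add_arc.
  - exact: functional_add_arc sinkA.
  move=> x y xR; rewrite !inE negb_or sinkA ?inE ?xR ?orbT // andbT xpair_eqE.
  apply: contraL xR => /andP[/eqP-> _].
  by apply/negP=> /nab; rewrite connect0.
have [|] := boolP [forall r in R, ~~ connect (del_edge e u v) u r].
  by move/forall_inP; exact: step.
(* The side of [u] contains the sink [r]. A sink [r'] on the side of [v] would be connected to [r]
   through [uv], hence equal to it, and [uv] would not be a bridge; so the arc leaves [v]. *)
case/forall_inPn=> r rR /negPn ur.
apply: (step v u) => [|r' r'R]; first by rewrite e_sym.
have -> : del_edge e v u = del_edge e u v.
  by rewrite /del_edge [[set v; u]]setUC.
have sub' : subrel (del_edge e u v) e by exact: del_edge_sub.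
apply/negP=> vr'; have eq_r : r = r'.
  apply: indep => //; rewrite (sym_connect_sym e_sym).
  apply: (connect_trans (y := v)).
    by rewrite (sym_connect_sym e_sym); exact: connect_subrel vr'.
  apply: (connect_trans (y := u)); first by rewrite connect1 // e_sym.
  exact: connect_subrel ur.
case/negP: (br u v euv); apply: connect_trans ur _.
by rewrite eq_r (sym_connect_sym (del_edge_sym u v e_sym)).
Qed.

Lemma one_cycle_functional_orientation e :
  symmetric e -> irreflexive e -> at_most_one_cycle e ->
  exists2 A, orientation e A & functional_arcs A.
Proof.
move=> e_sym e_irr one.
pose nonbridge (p : T * T) :=
  e p.1 p.2 && connect (del_edge e p.1 p.2) p.1 p.2.
have [[u v] /= /andP[euv cuv]|no_nb] := pickP nonbridge; last first.
  have [||A [oA funA _]] := all_bridges_orientation (R := set0) e_sym e_irr.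
  - by move=> u v euv; have := no_nb (u, v); rewrite /nonbridge /= euv /= => ->.
  - by move=> x y; rewrite inE.
  by exists A.
have [|||A [oA funA sinkA]] :=
    all_bridges_orientation (R := [set u]) (del_edge_sym u v e_sym).
- by move=> z; rewrite /del_edge e_irr.
- exact: del_nonbridge.
- by move=> x y; rewrite !inE => /eqP-> /eqP->.
exists ((u, v) |: A); first exact: orientation_add_arc.
by apply: (functional_add_arc (R := set0)); rewrite ?setU0.
Qed.

End Bridges.

Theorem theorem6p1 (T : finType) (e : rel T)
    (e_sym : symmetric e) (e_irr : irreflexive e)
    (e_conn : connected_graph e) :
  (beta_graph e 1 <= 1 <-> at_most_one_cycle e) /\
  (beta_graph e 1 = 1 <-> at_most_one_cycle e).
Proof.
have [T0 conn] := e_conn.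
have irrA A : orientation e A -> forall v, (v, v) \notin A.
  by move=> oA v; have := forallP (forallP oA v) v; rewrite e_irr.
have ge1 : 0 < beta_graph e 1.
  rewrite /beta_graph; elim/big_ind: _ => // [m n m0 n0|A _].
    by rewrite leq_min m0.
  exact: beta_oriented_gt0.
have le1 : beta_graph e 1 <= 1 <-> at_most_one_cycle e.
  split=> [/bigminn_witness[T1 c1 c2 [s1 /andP[_ U1]]|[A oA]] | one].
  (* The default value is at most 1 only if there is at most one vertex, which leaves no room for a
     cycle. *)
  - have c1_le1 := leq_trans (max_card (mem c1)) T1.
    by rewrite -(card_uniqP U1) ltnNge (leq_trans c1_le1) in s1.
  - move/(beta_oriented_le1 (irrA A oA)).
    exact: functional_orientation_one_cycle.
  have [A oA funA] := one_cycle_functional_orientation e_sym e_irr one.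
  apply: (leq_trans (bigminn_leq _ _ (mem_index_enum A) oA)).
  exact/(beta_oriented_le1 (irrA A oA)).
split=> //; split=> [eq1|/le1 le]; first by apply/le1; rewrite eq1.
by apply/eqP; rewrite eqn_leq le ge1.
Qed.
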